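(* With $\rho$, $\mathrm{MC}_9$ and $C_9$ as defined in the context, put, for positive integers $n$, $$E_9(n):=\pi-\sum_{m=0}^{n-1}\frac{\rho(m)}{16^m}-\frac{1}{16^n}\mathrm{MC}_9(n).$$ Then for all integers $n\ge 88$, $$\frac{16\,C_9}{15\cdot 16^n(n+1)^{23}}<E_9(n)<\frac{16\,C_9}{15\cdot 16^n(n+5)^{23}}.$$
   Context: $\rho(m)=\frac{4}{8m+1}-\frac{2}{8m+4}-\frac{1}{8m+5}-\frac{1}{8m+6}$ (so that $\pi=\sum_{m\ge 0}\rho(m)/16^m$). Finite continued fraction notation: $K_{j=1}^{k}\frac{a_j}{n+b_j}$ means $\cfrac{a_1}{n+b_1+\cfrac{a_2}{n+b_2+\cdots+\cfrac{a_k}{n+b_k}}}$. $$\mathrm{MC}_9(n)=\frac{\frac14}{(n+\frac{7}{16})^2-\frac{73}{256}+K_{j=1}^{9}\frac{a_j}{n+b_j}},$$ where $a_1=\frac{21}{64}$, $b_1=\frac{15}{7}$; $a_2=-\frac{265}{392}$, $b_2=\frac{9299}{2968}$; $a_3=-\frac{3381}{2809}$, $b_3=\frac{20517}{4876}$; $a_4=-\frac{18921}{8464}$, $b_4=\frac{94519}{21896}$; $a_5=-\frac{3260043}{453152}$, $b_5=\frac{25408967}{7496524}$; $a_6=-\frac{3740382415}{496062002}$, $b_6=\frac{482484243355}{72002790104}$; $a_7=-\frac{435259601465}{326597391169}$, $b_7=\frac{133863589556959}{4859799720860}$; $a_8=\frac{18170745077870217}{36157137144200}$, $b_8=-\frac{550189873911066313}{30042487323672220}$;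 $a_9=\frac{1184188272901493239625}{399390489791710771232}$, $b_9=\frac{55409761792537711960915}{5291704918098810592904}$. $C_9=-\frac{197080602286603349404715625}{1608316872287169019904}$ (a negative number). *)

(* Defs.v *)
From Stdlib Require Import Reals List.
Import ListNotations.
Open Scope R_scope.

Definition rho (m : nat) : R :=
  4 / (8 * INR m + 1) - 2 / (8 * INR m + 4)
  - 1 / (8 * INR m + 5) - 1 / (8 * INR m + 6).

(* The finite continued fraction a_1/(x + b_1 + a_2/(x + b_2 + ... +
   a_k/(x + b_k))), for the list of the pairs (a_j, b_j), j = 1, ..., k. *)
Fixpoint cfrac (ab : list (R * R)) (x : R) : R :=
  match ab with
  | [] => 0
  | (a, b) :: ab' => a / (x + b + cfrac ab' x)
  end.

Definition ab9 : list (R * R) :=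
  [ (21 / 64, 15 / 7);
    (- (265 / 392), 9299 / 2968);
    (- (3381 / 2809), 20517 / 4876);
    (- (18921 / 8464), 94519 / 21896);
    (- (3260043 / 453152), 25408967 / 7496524);
    (- (3740382415 / 496062002), 482484243355 / 72002790104);
    (- (435259601465 / 326597391169), 133863589556959 / 4859799720860);
    (18170745077870217 / 36157137144200,
     - (550189873911066313 / 30042487323672220));
    (1184188272901493239625 / 399390489791710771232,
     55409761792537711960915 / 5291704918098810592904) ].

(* For n >= 19 every denominator occurring here is positive, so no division by
   zero is involved. *)
Definition MC9 (n : nat) : R :=
  (1 / 4) / ((INR n + 7 / 16) ^ 2 - 73 / 256 + cfrac ab9 (INR n)).

Definition C9 : R :=
  - (197080602286603349404715625 / 1608316872287169019904).

(* Meant for n >= 1: [sum_f_R0 f k] is f 0 + ... + f k, so the sum runs over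
   m = 0, ..., n - 1. *)
Definition E9 (n : nat) : R :=
  PI - sum_f_R0 (fun m => rho m / 16 ^ m) (n - 1) - 1 / 16 ^ n * MC9 n.

(* Main.v *)
(** Both bounds, like [E9 n], tend to 0, so it suffices to compare the
    differences of consecutive terms.  The difference [E9 n - E9 (S n)] is
    [16 ^ -n] times a rational function of [n], and the two comparisons become
    polynomial inequalities whose coefficients all have the same sign once they
    are expanded around [n = 88].

    That [E9] tends to 0 is the BBP formula.  On [[0, 1]] the function
    [2 ln (2 - y^2) - 2 ln (y^2 - 2 y + 2) + 4 atan (y - 1)], which increases by
    [PI] from 0 to 1, has derivative
    [(4 - 2 y^3 - y^4 - y^5) / (1 - y^8 / 16)]; the partial sums of [rho m / 16 ^ m]
    integrate the partial sums of the geometric expansion in [y^8 / 16]. *)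

Require Import Defs.
From Stdlib Require Import Reals.
From Stdlib Require Import ZArith List Lra Lia.
From Coquelicot Require Import Coquelicot.
Import ListNotations.
Open Scope R_scope.

(** * Positivity of rational functions on a half-line *)

(** Coefficients are integers, constant term first, so that [vm_compute] can carry out the
    polynomial arithmetic. *)
Fixpoint peval (p : list Z) (t : R) : R :=
  match p with
  | [] => 0
  | c :: p' => IZR c + t * peval p' t
  end.

Fixpoint padd (p q : list Z) : list Z :=
  match p, q with
  | [], _ => q
  | _, [] => p
  | a :: p', b :: q' => (a + b)%Z :: padd p' q'
  end.

Definition pscale (c : Z) (p : list Z) : list Z := map (Z.mul c) p.

Fixpoint pmul (p q : list Z) : list Z :=
  match p with
  | [] => []
  | a :: p' => padd (pscale a q) (0%Z :: pmul p' q)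
  end.

Fixpoint ppow (p : list Z) (k : nat) : list Z :=
  match k with
  | O => [1%Z]
  | S k' => pmul p (ppow p k')
  end.

(** A syntactic criterion, sufficient but not necessary for positivity at all [t >= 0]. *)
Definition ppos (p : list Z) : bool :=
  match p with
  | [] => false
  | c :: p' => (0 <? c)%Z && forallb (Z.leb 0) p'
  end.

Definition pcontent (p : list Z) : Z := fold_right Z.gcd 0%Z p.

Definition pdiv (g : Z) (p : list Z) : list Z := map (fun c => (c / g)%Z) p.

(** Only the common integer content is cancelled, which requires no polynomial gcd. *)
Definition reduce (n d : list Z) : list Z * list Z :=
  let g := Z.gcd (pcontent n) (pcontent d) in (pdiv g n, pdiv g d).

Lemma peval_add p q t : peval (padd p q) t = peval p t + peval q t.
Proof.
  revert q; induction p as [|a p IH]; intros [|b q]; simpl; try ring.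
  rewrite IH, plus_IZR; ring.
Qed.

Lemma peval_scale c p t : peval (pscale c p) t = IZR c * peval p t.
Proof.
  induction p as [|a p IH]; cbn [pscale map peval].
  - ring.
  - unfold pscale in IH; rewrite IH, mult_IZR; ring.
Qed.

Lemma peval_mul p q t : peval (pmul p q) t = peval p t * peval q t.
Proof.
  induction p as [|a p IH]; cbn [pmul peval].
  - ring.
  - rewrite peval_add, peval_scale; cbn [peval]; rewrite IH; ring.
Qed.

Lemma peval_pow p k t : peval (ppow p k) t = peval p t ^ k.
Proof.
  induction k as [|k IH]; simpl.
  - ring.
  - rewrite peval_mul, IH; ring.
Qed.

Lemma ppos_sound p t : ppos p = true -> 0 <= t -> 0 < peval p t.
Proof.
  intros Hp Ht; destruct p as [|c p]; [discriminate|].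
  apply andb_prop in Hp; destruct Hp as [Hc Hp]; cbn [peval].
  apply Z.ltb_lt, IZR_lt in Hc.
  enough (0 <= peval p t) by nra.
  clear Hc; induction p as [|a p IH]; cbn [peval].
  - lra.
  - apply andb_prop in Hp; destruct Hp as [Ha Hp].
    apply Z.leb_le, IZR_le in Ha; specialize (IH Hp); nra.
Qed.

Lemma peval_div g p t :
  (g | pcontent p)%Z -> peval p t = IZR g * peval (pdiv g p) t.
Proof.
  induction p as [|c p IH]; cbn [pcontent pdiv fold_right map peval]; intros Hg.
  - ring.
  - assert (Hc : (g | c)%Z)
      by (apply (Z.divide_trans _ _ _ Hg), Z.gcd_divide_l).
    assert (Hp : (g | pcontent p)%Z)
      by (apply (Z.divide_trans _ _ _ Hg), Z.gcd_divide_r).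
    assert (E : (c = g * (c / g))%Z).
    (* For [g = 0] divisibility forces [c = 0]. *)
    { destruct (Z.eq_dec g 0) as [->|Hg0].
      - destruct Hc as [k ->]; lia.
      - apply Z.div_exact; [|apply Z.mod_divide]; assumption. }
    rewrite (IH Hp), E, mult_IZR at 1.
    unfold pdiv; ring.
Qed.

Lemma reduce_sound n d t n' d' :
  0 < peval d t -> Some (reduce n d) = Some (n', d') ->
  0 < peval d' t /\ peval n' t / peval d' t = peval n t / peval d t.
Proof.
  unfold reduce; set (g := Z.gcd _ _); intros Hd H; injection H as <- <-.
  assert (Hg := IZR_le _ _ (Z.gcd_nonneg (pcontent n) (pcontent d))); fold g in Hg.
  rewrite (peval_div g d) in * by apply Z.gcd_divide_r.
  rewrite (peval_div g n) by apply Z.gcd_divide_l.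
  (* [g = 0] would make the original denominator vanish. *)
  assert (0 < IZR g) by (destruct Hg as [|Hg]; [|rewrite <- Hg in Hd]; lra).
  assert (0 < peval (pdiv g d) t)
    by (apply (Rmult_lt_reg_l (IZR g)); [|rewrite Rmult_0_r]; assumption).
  split; [assumption|field; lra].
Qed.

(** * Reified rational expressions *)

Inductive rexp : Type :=
  | Var
  | Cst (z : Z)
  | Opp (e : rexp)
  | Add (e1 e2 : rexp)
  | Sub (e1 e2 : rexp)
  | Mul (e1 e2 : rexp)
  | Div (e1 e2 : rexp)
  | Pow (e : rexp) (k : nat).

Fixpoint reval (e : rexp) (x : R) : R :=
  match e with
  | Var => x
  | Cst z => IZR z
  | Opp e => - reval e x
  | Add e1 e2 => reval e1 x + reval e2 x
  | Sub e1 e2 => reval e1 x - reval e2 x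
  | Mul e1 e2 => reval e1 x * reval e2 x
  | Div e1 e2 => reval e1 x / reval e2 x
  | Pow e k => reval e x ^ k
  end.

(* Numerator and denominator in the variable [t = x - s]; the result is [None]
   when some divisor is not visibly positive for [t >= 0].  Without the
   reductions the coefficients of the continued fractions explode. *)
Fixpoint rfrac (s : Z) (e : rexp) : option (list Z * list Z) :=
  match e with
  | Var => Some ([s; 1%Z], [1%Z])
  | Cst z => Some ([z], [1%Z])
  | Opp e =>
      match rfrac s e with
      | Some (n, d) => Some (pscale (-1) n, d)
      | None => None
      end
  | Add e1 e2 =>
      match rfrac s e1, rfrac s e2 with
      | Some (n1, d1), Some (n2, d2) =>
          Some (padd (pmul n1 d2) (pmul n2 d1), pmul d1 d2)
      | _, _ => None
      end
  | Sub e1 e2 =>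
      match rfrac s e1, rfrac s e2 with
      | Some (n1, d1), Some (n2, d2) =>
          Some (padd (pmul n1 d2) (pscale (-1) (pmul n2 d1)), pmul d1 d2)
      | _, _ => None
      end
  | Mul e1 e2 =>
      match rfrac s e1, rfrac s e2 with
      | Some (n1, d1), Some (n2, d2) => Some (pmul n1 n2, pmul d1 d2)
      | _, _ => None
      end
  | Div e1 e2 =>
      match rfrac s e1, rfrac s e2 with
      | Some (n1, d1), Some (n2, d2) =>
          if ppos n2 then Some (reduce (pmul n1 d2) (pmul d1 n2)) else None
      | _, _ => None
      end
  | Pow e k =>
      match rfrac s e with
      | Some (n, d) => Some (ppow n k, ppow d k)
      | None => None
      end
  end.

(** The positive denominator is the invariant that justifies each [field] step; in the quotient case
    [ppos n2] supplies it for the divisor's numerator, which moves into the denominator. *)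
Lemma rfrac_sound s e x n d :
  IZR s <= x -> rfrac s e = Some (n, d) ->
  0 < peval d (x - IZR s) /\
  reval e x = peval n (x - IZR s) / peval d (x - IZR s).
Proof.
  intros Hx; revert n d.
  induction e as [|z|e IH|e1 IH1 e2 IH2|e1 IH1 e2 IH2|e1 IH1 e2 IH2|e1 IH1 e2 IH2
                  |e IH k]; cbn [rfrac reval]; intros n d H;
    try (destruct (rfrac s e) as [[n1 d1]|]; [|discriminate];
         destruct (IH _ _ eq_refl) as [P1 ->]);
    try (destruct (rfrac s e1) as [[n1 d1]|]; [|discriminate];
         destruct (rfrac s e2) as [[n2 d2]|]; [|discriminate];
         destruct (IH1 _ _ eq_refl) as [P1 ->];
         destruct (IH2 _ _ eq_refl) as [P2 ->]);
    try (injection H as <- <-;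
         repeat rewrite ?peval_add, ?peval_scale, ?peval_mul, ?peval_pow).
  - simpl; split; [lra|field].
  - simpl; split; [lra|field].
  - split; [assumption|field; lra].
  - split; [apply Rmult_lt_0_compat; assumption|field; lra].
  - split; [apply Rmult_lt_0_compat; assumption|field; lra].
  - split; [apply Rmult_lt_0_compat; assumption|field; lra].
  - destruct (ppos n2) eqn:Hn2; [|discriminate].
    assert (0 < peval n2 (x - IZR s)) by (apply ppos_sound; [assumption|lra]).
    apply reduce_sound with (t := x - IZR s) in H; rewrite !peval_mul in *;
      [destruct H as [Hd ->]|].
    + split; [exact Hd|field; lra].
    + apply Rmult_lt_0_compat; assumption.
  - split; [apply pow_lt; assumption|].
    unfold Rdiv; rewrite Rpow_mult_distr, pow_inv; reflexivity.
Qed.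

Definition rpos (s : Z) (e : rexp) : bool :=
  match rfrac s e with
  | Some (n, _) => ppos n
  | None => false
  end.

Lemma rpos_sound s e x : rpos s e = true -> IZR s <= x -> 0 < reval e x.
Proof.
  unfold rpos; intros He Hx.
  destruct (rfrac s e) as [[n d]|] eqn:E; [|discriminate].
  destruct (rfrac_sound _ _ _ _ _ Hx E) as [Hd ->].
  apply Rdiv_lt_0_compat; [|exact Hd].
  apply ppos_sound; [exact He|lra].
Qed.

Ltac reify x e :=
  lazymatch e with
  | x => constr:(Var)
  | IZR ?z => constr:(Cst z)
  | - ?a => let a' := reify x a in constr:(Opp a')
  | ?a + ?b => let a' := reify x a in let b' := reify x b in constr:(Add a' b')
  | ?a - ?b => let a' := reify x a in let b' := reify x b in constr:(Sub a' b')
  | ?a * ?b => let a' := reify x a in let b' := reify x b in constr:(Mul a' b')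
  | ?a / ?b => let a' := reify x a in let b' := reify x b in constr:(Div a' b')
  | ?a ^ ?k => let a' := reify x a in constr:(Pow a' k)
  end.

Ltac rational_lt x s :=
  apply Rlt_0_minus;
  lazymatch goal with
  | |- 0 < ?e =>
      let e' := reify x e in
      change (0 < reval e' x);
      apply (rpos_sound s); [vm_compute; reflexivity|lra]
  end.

(** * The remainder of the BBP series *)

(** The antiderivative, vanishing at 0, of the [m]-th term of the geometric expansion; its value at
    1 is [rho m / 16 ^ m]. *)
Definition bbp_term (m : nat) (y : R) : R :=
  (4 * y ^ (8 * m + 1) / (8 * INR m + 1) - 2 * y ^ (8 * m + 4) / (8 * INR m + 4)
   - y ^ (8 * m + 5) / (8 * INR m + 5) - y ^ (8 * m + 6) / (8 * INR m + 6)) / 16 ^ m.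

Definition bbp_primitive (y : R) : R :=
  2 * ln (2 - y ^ 2) - 2 * ln (y ^ 2 - 2 * y + 2) + 4 * atan (y - 1).

Lemma is_derive_bbp_term m y :
  is_derive (bbp_term m) y ((4 - 2 * y ^ 3 - y ^ 4 - y ^ 5) * (y ^ 8 / 16) ^ m).
Proof.
  assert (Hm := pos_INR m).
  assert (H16 : 16 ^ m <> 0) by (apply pow_nonzero; lra).
  assert (Hk : INR (8 * m) = 8 * INR m) by (rewrite mult_INR; simpl; ring).
  unfold bbp_term, Rdiv; rewrite Rpow_mult_distr, pow_inv, <- pow_mult.
  (* With [8 * m] opaque, all exponents are successors of [k], and [y ^ k] is an atom for
     [field]. *)
  generalize dependent (8 * m)%nat; intros k Hk.
  auto_derive; [exact I|].
  rewrite !Nat.add_succ_r, !Nat.add_0_r, !S_INR, Hk; simpl; field.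
  repeat split; lra.
Qed.

(** The numerator is [(1 - y) (y ^ 2 + 2) (y ^ 2 + 2 y + 2)], so the quotient reduces to [16 (1 - y)
    / ((2 - y ^ 2) (y ^ 2 - 2 y + 2))], whose partial fractions integrate to the logarithms and the
    arctangent. *)
Lemma is_derive_bbp_primitive y :
  0 <= y <= 1 ->
  is_derive bbp_primitive y ((4 - 2 * y ^ 3 - y ^ 4 - y ^ 5) / (1 - y ^ 8 / 16)).
Proof.
  intros Hy.
  assert (H1 : 0 < 2 - y ^ 2) by nra.
  assert (H2 : 0 < y ^ 2 - 2 * y + 2) by nra.
  assert (H3 : 0 < y ^ 2 + 2 * y + 2) by nra.
  assert (H4 : 0 < y ^ 2 + 2) by nra.
  assert (H8 : 16 - y ^ 8
               = (2 - y ^ 2) * (y ^ 2 + 2) * (y ^ 2 - 2 * y + 2) * (y ^ 2 + 2 * y + 2))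
    by ring.
  assert (0 < 16 - y ^ 8)
    by (rewrite H8; repeat apply Rmult_lt_0_compat; assumption).
  unfold bbp_primitive; auto_derive.
  - simpl in *; repeat split; lra.
  - field; simpl in *; repeat split; nra.
Qed.

(** Geometric tail: with [q = y ^ 8 / 16], removing the terms up to [q ^ N] from [1 / (1 - q)]
    leaves [q ^ S N / (1 - q)]. *)
Lemma is_derive_bbp_remainder N y :
  0 <= y <= 1 ->
  is_derive (fun y => bbp_primitive y - sum_f_R0 (fun m => bbp_term m y) N) y
    ((4 - 2 * y ^ 3 - y ^ 4 - y ^ 5) / (1 - y ^ 8 / 16) * (y ^ 8 / 16) ^ S N).
Proof.
  intros Hy.
  assert (Hq : y ^ 8 <= 1) by (rewrite <- (pow1 8); apply pow_incr; lra).
  induction N as [|N IH].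
  - cbn [sum_f_R0].
    evar_last.
    + apply (is_derive_minus bbp_primitive (bbp_term 0)).
      * apply is_derive_bbp_primitive, Hy.
      * apply is_derive_bbp_term.
    + unfold minus, plus, opp; simpl AbelianGroup.sort; simpl; field; simpl in Hq; lra.
  - apply is_derive_ext with
      (f := fun y => bbp_primitive y - sum_f_R0 (fun m => bbp_term m y) N
                     - bbp_term (S N) y).
    (* The equation is retyped from the carrier of a normed module to [R], for [ring]. *)
    + intros z; refine (_ : @eq R _ _); cbn [sum_f_R0]; ring.
    + evar_last.
      * apply (is_derive_minus
          (fun y => bbp_primitive y - sum_f_R0 (fun m => bbp_term m y) N)
          (bbp_term (S N))); [exact IH|apply is_derive_bbp_term].
      * unfold minus, plus, opp; cbn -[pow].
        generalize (y ^ 8) Hq; clear; intros q Hq; simpl; field; lra.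
Qed.

(** Mean value theorem on [[0, 1]]: the increment of the primitive minus the partial sum is the
    remainder. *)
Lemma bbp_remainder_bound N :
  Rabs (PI - sum_f_R0 (fun m => rho m / 16 ^ m) N) <= 9 / 16 ^ S N.
Proof.
  set (H := fun y => bbp_primitive y - sum_f_R0 (fun m => bbp_term m y) N).
  assert (H1 : H 1 = - sum_f_R0 (fun m => rho m / 16 ^ m) N).
  { unfold H, bbp_primitive.
    replace (2 - 1 ^ 2) with 1 by ring.
    replace (1 ^ 2 - 2 * 1 + 2) with 1 by ring.
    replace (1 - 1) with 0 by ring.
    rewrite ln_1, atan_0.
    rewrite (sum_eq _ (fun m => rho m / 16 ^ m)); [ring|].
    intros m _; unfold bbp_term, rho, Rdiv; rewrite !pow1; ring. }
  assert (H0 : H 0 = - PI).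
  { unfold H, bbp_primitive.
    replace (2 - 0 ^ 2) with 2 by ring.
    replace (0 ^ 2 - 2 * 0 + 2) with 2 by ring.
    (* A plain [-1] would be an integer literal, which [atan_opp] does not match. *)
    replace (0 - 1) with (Ropp 1) by ring.
    rewrite atan_opp, atan_1.
    rewrite (sum_eq _ (fun _ => 0)).
    - rewrite sum_cte; field.
    - intros m _; unfold bbp_term, Rdiv; rewrite !pow_i by lia; ring. }
  destruct (MVT_gen H 0 1
    (fun y => (4 - 2 * y ^ 3 - y ^ 4 - y ^ 5) / (1 - y ^ 8 / 16) * (y ^ 8 / 16) ^ S N))
    as [c [Hc E]].
  - rewrite Rmin_left, Rmax_right by lra; intros y Hy.
    apply is_derive_bbp_remainder; lra.
  - rewrite Rmin_left, Rmax_right by lra; intros y Hy.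
    apply continuity_pt_filterlim, (ex_derive_continuous H).
    eexists; apply is_derive_bbp_remainder, Hy.
  - rewrite Rmin_left, Rmax_right in Hc by lra.
    replace (PI - _) with (H 1 - H 0) by (rewrite H1, H0; ring).
    rewrite E, Rminus_0_r, Rmult_1_r, Rabs_mult.
    assert (Hpow : forall k, 0 <= c ^ k <= 1).
    { intros k; split; [apply pow_le; lra|].
      rewrite <- (pow1 k); apply pow_incr; lra. }
    assert (P3 := Hpow 3%nat); assert (P4 := Hpow 4%nat).
    assert (P5 := Hpow 5%nat); assert (P8 := Hpow 8%nat).
    apply Rmult_le_compat; try apply Rabs_pos.
    (* The numerator lies in [[0, 4]] and the denominator is at least [15 / 16], so 9 is
       generous. *)
    + unfold Rdiv at 1; rewrite Rabs_mult, Rabs_inv, (Rabs_pos_eq (1 - _)) by lra.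
      apply Rle_div_l; [lra|]; apply Rabs_le; lra.
    + rewrite <- pow_inv, Rabs_pos_eq by (apply pow_le; lra).
      apply pow_incr; lra.
Qed.

(** * Comparison of consecutive terms *)

Definition MC9R (x : R) : R :=
  (1 / 4) / ((x + 7 / 16) ^ 2 - 73 / 256 + cfrac ab9 x).

Definition rhoR (x : R) : R :=
  4 / (8 * x + 1) - 2 / (8 * x + 4) - 1 / (8 * x + 5) - 1 / (8 * x + 6).

Lemma MC9R_bounds x : 88 <= x -> 0 < MC9R x < 1.
Proof.
  intros Hx; unfold MC9R; cbn [cfrac ab9]; split; rational_lt x 88%Z.
Qed.

(** The steps of the lower bound and of [E9], multiplied by [16 ^ n]. Since [16 / 15 - 1 / 15 = 1],
    both sides behave like [C9 / x ^ 23], and only lower-order terms separate them. *)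
Lemma decrement_lower x :
  88 <= x ->
  16 * C9 / (15 * (x + 1) ^ 23) - C9 / (15 * (x + 1 + 1) ^ 23)
  < rhoR x - MC9R x + MC9R (x + 1) / 16.
Proof.
  intros Hx; unfold rhoR, MC9R, C9; cbn [cfrac ab9]; rational_lt x 88%Z.
Qed.

Lemma decrement_upper x :
  88 <= x ->
  rhoR x - MC9R x + MC9R (x + 1) / 16
  < 16 * C9 / (15 * (x + 5) ^ 23) - C9 / (15 * (x + 1 + 5) ^ 23).
Proof.
  intros Hx; unfold rhoR, MC9R, C9; cbn [cfrac ab9]; rational_lt x 88%Z.
Qed.

(** The lower bound is the case [s = 1], the upper bound [s = 5]. *)
Definition bound9 (s : R) (n : nat) : R :=
  16 * C9 / (15 * 16 ^ n * (INR n + s) ^ 23).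

Lemma E9_decrement n :
  (1 <= n)%nat ->
  E9 n - E9 (S n) = (rhoR (INR n) - MC9R (INR n) + MC9R (INR n + 1) / 16) / 16 ^ n.
Proof.
  intros Hn; unfold E9, MC9.
  fold (MC9R (INR n)); fold (MC9R (INR (S n))).
  (* [n >= 1] keeps the truncated subtraction exact, so the two sums differ by the term of index
     [n]. *)
  replace (S n - 1)%nat with (S (n - 1)) by lia.
  cbn [sum_f_R0]; replace (S (n - 1)) with n by lia.
  change (rho n) with (rhoR (INR n)); rewrite S_INR.
  change (16 ^ S n) with (16 * 16 ^ n).
  field; apply pow_nonzero; lra.
Qed.

Lemma bound9_decrement s n :
  0 < s ->
  bound9 s n - bound9 s (S n)
  = (16 * C9 / (15 * (INR n + s) ^ 23) - C9 / (15 * (INR n + 1 + s) ^ 23)) / 16 ^ n.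
Proof.
  intros Hs; unfold bound9; rewrite S_INR.
  change (16 ^ S n) with (16 * 16 ^ n).
  assert (Hn := pos_INR n).
  assert (A1 : (INR n + s) ^ 23 <> 0) by (apply pow_nonzero; lra).
  assert (A2 : (INR n + 1 + s) ^ 23 <> 0) by (apply pow_nonzero; lra).
  assert (A3 : 16 ^ n <> 0) by (apply pow_nonzero; lra).
  (* Powers become atoms, lest [field] expand them. *)
  generalize dependent ((INR n + s) ^ 23).
  generalize dependent ((INR n + 1 + s) ^ 23).
  generalize dependent (16 ^ n); intros; field; auto.
Qed.

(** * Decay to 0 and passage from differences to values *)

Lemma E9_bound n : (88 <= n)%nat -> Rabs (E9 n) <= 10 / 16 ^ n.
Proof.
  intros Hn.
  assert (Hx : 88 <= INR n) by (apply (le_INR 88) in Hn; simpl in Hn; lra).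
  assert (B := bbp_remainder_bound (n - 1)).
  replace (S (n - 1)) with n in B by lia.
  assert (M := MC9R_bounds _ Hx); change (MC9R (INR n)) with (MC9 n) in M.
  assert (P : 0 < / 16 ^ n) by (apply Rinv_0_lt_compat, pow_lt; lra).
  unfold Rdiv in *; apply Rabs_le_between in B.
  (* The 10 is 9 from the BBP remainder plus 1 from [MC9 n < 1]. *)
  unfold E9, Rdiv; apply Rabs_le; nra.
Qed.

Lemma bound9_bound s n : 1 <= s -> Rabs (bound9 s n) <= - 2 * C9 / 16 ^ n.
Proof.
  intros Hs; assert (Hn := pos_INR n).
  assert (P : 0 < 16 ^ n) by (apply pow_lt; lra).
  assert (Q : 1 <= (INR n + s) ^ 23) by (apply pow_R1_Rle; lra).
  assert (Q' : 0 < / (INR n + s) ^ 23 <= 1).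
  { split; [apply Rinv_0_lt_compat; lra|].
    rewrite <- Rinv_1; apply Rinv_le_contravar; lra. }
  assert (HC : C9 < 0) by (unfold C9; lra).
  replace (bound9 s n) with (16 / 15 * C9 * / (INR n + s) ^ 23 / 16 ^ n)
    by (unfold bound9; generalize dependent ((INR n + s) ^ 23); intros; field; lra).
  unfold Rdiv at 1; rewrite Rabs_mult, Rabs_inv, (Rabs_pos_eq (16 ^ n)) by lra.
  apply Rmult_le_compat_r; [apply Rlt_le, Rinv_0_lt_compat, P|].
  apply Rabs_le; nra.
Qed.

Lemma is_lim_seq_of_geom_bound (u : nat -> R) (N : nat) (K : R) :
  (forall n, (N <= n)%nat -> Rabs (u n) <= K / 16 ^ n) -> is_lim_seq u 0.
Proof.
  intros Hu; apply is_lim_seq_abs_0.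
  apply is_lim_seq_le_le_loc with (u := fun _ => 0) (w := fun n => K * (/ 16) ^ n).
  - exists N; intros n Hn; split; [apply Rabs_pos|].
    rewrite pow_inv; apply Hu, Hn.
  - apply is_lim_seq_const.
  - replace (Finite 0) with (Rbar_mult K 0) by (simpl; f_equal; ring).
    apply is_lim_seq_scal_l, is_lim_seq_geom; rewrite Rabs_pos_eq; lra.
Qed.

(** From [N] on, [u - v] increases strictly, and it tends to 0, so it stays negative. *)
Lemma lt_of_decrement_lt (u v : nat -> R) (N n : nat) :
  is_lim_seq u 0 -> is_lim_seq v 0 ->
  (forall k, (N <= k)%nat -> u k - u (S k) < v k - v (S k)) ->
  (N <= n)%nat -> u n < v n.
Proof.
  intros Hu Hv Huv Hn.
  assert (L : is_lim_seq (fun k => u (k + S n)%nat - v (k + S n)%nat) 0).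
  { apply (is_lim_seq_incr_n (fun k => u k - v k)).
    replace (Finite 0) with (Finite (0 - 0)) by (f_equal; ring).
    apply is_lim_seq_minus'; assumption. }
  assert (I := is_lim_seq_incr_compare _ _ L).
  assert (D : forall k, (N <= k)%nat -> u k - v k < u (S k) - v (S k))
    by (intros k Hk; specialize (Huv k Hk); lra).
  (* Monotone convergence gives only [<= 0] at [S n]; the strict step from [n] to [S n] makes the
     inequality at [n] strict. *)
  specialize (I (fun k => Rlt_le _ _ (D (k + S n)%nat ltac:(lia))) 0%nat).
  simpl in I; specialize (D n Hn); lra.
Qed.

Theorem theorem2 (n : nat) (hn : (88 <= n)%nat) :
  16 * C9 / (15 * 16 ^ n * (INR n + 1) ^ 23) < E9 n
  /\ E9 n < 16 * C9 / (15 * 16 ^ n * (INR n + 5) ^ 23).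
Proof.
  assert (LE : is_lim_seq E9 0) by exact (is_lim_seq_of_geom_bound _ _ _ E9_bound).
  assert (LB : forall s, 1 <= s -> is_lim_seq (bound9 s) 0).
  { intros s Hs; apply is_lim_seq_of_geom_bound with (N := 0%nat) (K := - 2 * C9).
    intros k _; apply bound9_bound, Hs. }
  split.
  - apply (lt_of_decrement_lt (bound9 1) E9 88);
      [apply LB; lra|exact LE| |exact hn].
    intros k Hk; rewrite bound9_decrement, E9_decrement by (lra || lia).
    apply Rmult_lt_compat_r; [apply Rinv_0_lt_compat, pow_lt; lra|].
    apply decrement_lower; apply (le_INR 88) in Hk; simpl in Hk; lra.
  - apply (lt_of_decrement_lt E9 (bound9 5) 88);
      [exact LE|apply LB; lra| |exact hn].
    intros k Hk; rewrite bound9_decrement, E9_decrement by (lra || lia).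
    apply Rmult_lt_compat_r; [apply Rinv_0_lt_compat, pow_lt; lra|].
    apply decrement_upper; apply (le_INR 88) in Hk; simpl in Hk; lra.
Qed.
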